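(* The set $\Pi$ of parallelograms conformally inscribed in $\mathbf{C}$, with vertexwise addition and scalar multiplication and the inner product $\langle P,Q\rangle = P_{AC}\cdot Q_{AC}+P_{BD}\cdot Q_{BD}$, is a Euclidean space (a finite-dimensional real inner product space) having an orthonormal basis consisting of three parallelograms $U,V,T$ such that $U$ and $V$ are degenerate parallelograms, $U_{AC}=V_{BD}=\mathbf{0}$, and $T_{AC}\cdot V_{AC}=T_{BD}\cdot U_{BD}=0$. The parallelograms $U$ and $V$ are at infinity if and only if at least one of the pairs $A,C$ or $B,D$ consists of parallel lines.
   Context: Setting. $A,B,C,D$ are lines in $\mathbb{R}^2$ with equations $A: y=m_Ax+b_A$, $B: y=m_Bx+1$, $C: y=m_Cx$, $D: y=m_Dx$ (real $m_A,m_B,m_C,m_D,b_A$), such that the four lines do not all meet in a single point and $C,D$ meet only in the origin ($m_C\neq m_D$). $\mathbf{C}$ denotes the configuration consisting of the two pairs $A,C$ and $B,D$. Two lines are called parallel if they have equal slopes (coincident lines included). For $w\in\mathbb{R}$: $A(w): y=m_Ax+b_Aw$, $B(w): y=m_Bx+w$, $C(w)=C$, $D(w)=D$, and $\mathbf{C}(w)$ is the configuration of the pairs $A(w),C(w)$ and $B(w),D(w)$. A parallelogram inscribed in $\mathbf{C}(w)$ is a parallelogram whose vertices $(x_L,y_L)$, $L\in\{A,B,C,D\}$, lie in sequence (clockwise or counterclockwise) on the lines $A(w),B(w),C(w),D(w)$, i.e. $(x_L,y_L)\in L(w)$ and the midpoints of the diagonals coincide: $(x_A,y_A)+(x_C,y_C)=(x_B,y_B)+(x_D,y_D)$.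 Degenerate parallelograms (all sides on one line, or all vertices equal to one point) are allowed. A parallelogram is conformally inscribed in $\mathbf{C}$ if it is inscribed in $\mathbf{C}(w)$ for some $w\in\mathbb{R}$; $w$ is its scale; it is at infinity if $w=0$. $\Pi$ is the set of all parallelograms conformally inscribed in $\mathbf{C}$, a vector space under coordinatewise addition and scalar multiplication of vertices (scales add and multiply accordingly). For $P\in\Pi$, the diagonal vectors are $P_{AC}=(x_A-x_C,y_A-y_C)$ and $P_{BD}=(x_B-x_D,y_B-y_D)$; $\cdot$ is the dot product of $\mathbb{R}^2$. *)

(* Defs.v *)
From HB Require Import structures.
From mathcomp Require Import all_boot all_order all_algebra.
From mathcomp Require Import reals.

Set Implicit Arguments.
Unset Strict Implicit.
Unset Printing Implicit Defensive.

Import Order.TTheory GRing.Theory Num.Theory.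

Local Open Scope ring_scope.

(* [Line m b] is the line y = m x + b of the plane 'rV[R]_2. *)
Record line (R : realType) := Line { slope : R; intercept : R }.

Definition on_line (R : realType) (L : line R) (p : 'rV[R]_2) : Prop :=
  p 0 1 = slope L * p 0 0 + intercept L.

(* Coincident lines count as parallel. *)
Definition parallel (R : realType) (L M : line R) : Prop := slope L = slope M.

Definition rescale_line (R : realType) (w : R) (L : line R) : line R :=
  Line (slope L) (intercept L * w).

(* A configuration: the pair of lines A, C and the pair of lines B, D. *)
Record config (R : realType) :=
  Config { lineA : line R; lineB : line R; lineC : line R; lineD : line R }.

Definition rescale (R : realType) (w : R) (K : config R) : config R :=
  Config (rescale_line w (lineA K)) (rescale_line w (lineB K))
         (rescale_line w (lineC K)) (rescale_line w (lineD K)).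

Definition concurrent (R : realType) (K : config R) : Prop :=
  exists p : 'rV[R]_2,
    [/\ on_line (lineA K) p, on_line (lineB K) p,
        on_line (lineC K) p & on_line (lineD K) p].

(* The rows of a 4 x 2 matrix are the vertices on the lines A, B, C, D, in this
   order, so that matrix addition and scaling act vertexwise. *)
Definition quad (R : realType) := 'M[R]_(4, 2).

Definition vtxA (R : realType) (P : quad R) : 'rV[R]_2 := row 0 P.
Definition vtxB (R : realType) (P : quad R) : 'rV[R]_2 := row 1 P.
Definition vtxC (R : realType) (P : quad R) : 'rV[R]_2 := row 2 P.
Definition vtxD (R : realType) (P : quad R) : 'rV[R]_2 := row 3 P.

Definition is_parallelogram (R : realType) (P : quad R) : Prop :=
  vtxA P + vtxC P = vtxB P + vtxD P.

(* The case d = 0 is that of four equal vertices. *)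
Definition degenerate (R : realType) (P : quad R) : Prop :=
  exists p d : 'rV[R]_2, forall i : 'I_4, exists t : R, row i P = p + t *: d.

Definition inscribed (R : realType) (K : config R) (P : quad R) : Prop :=
  is_parallelogram P /\
  [/\ on_line (lineA K) (vtxA P), on_line (lineB K) (vtxB P),
      on_line (lineC K) (vtxC P) & on_line (lineD K) (vtxD P)].

Definition conformally_inscribed (R : realType) (K : config R) (P : quad R) :
  Prop := exists w : R, inscribed (rescale w K) P.

Definition at_infinity (R : realType) (K : config R) (P : quad R) : Prop :=
  inscribed (rescale 0 K) P.

Definition diagAC (R : realType) (P : quad R) : 'rV[R]_2 := vtxA P - vtxC P.
Definition diagBD (R : realType) (P : quad R) : 'rV[R]_2 := vtxB P - vtxD P.

Definition dotp (R : realType) (u v : 'rV[R]_2) : R := (u *m v^T) 0 0.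

Definition inner (R : realType) (P Q : quad R) : R :=
  dotp (diagAC P) (diagAC Q) + dotp (diagBD P) (diagBD Q).

(* Main.v *)
(* As the slopes of C and D differ, an inscribed parallelogram is determined by
   its vertices on A(w) and B(w), hence by two abscissas and the scale, and these
   are arbitrary: Pi has dimension 3.  The form is definite on Pi because
   vanishing diagonals force all vertices to be the origin.  Nonzero U and V with
   U_AC = 0 and V_BD = 0 are given by explicit formulas; they are orthogonal
   whatever the other diagonals are, and a vector T orthogonal to both satisfies
   T_BD.U_BD = T_AC.V_AC = 0.  In the parallel cases the solution space for U or
   V may be a plane, and the formulas select a solution of scale 0; conversely,
   without parallel pairs, a U of scale 0 vanishes. *)
Require Import Defs.
From HB Require Import structures.
From mathcomp Require Import all_boot all_order all_algebra.
From mathcomp Require Import reals.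
From mathcomp Require Import ring lra.

Set Implicit Arguments.
Unset Strict Implicit.
Unset Printing Implicit Defensive.

Import Order.TTheory GRing.Theory Num.Theory.

Local Open Scope ring_scope.

(** * Orthonormal families for an abstract real dot product *)

Section DotForms.
Variables (R : rcfType) (vT : vectType R) (form : {dot vT for idfun}).

Lemma dot_sym u v : form u v = form v u.
Proof. by rewrite hermC expr0 mul1r. Qed.

Lemma mem_orthov1_dot u v : (v \in orthov form <[u]>) = (form u v == 0).
Proof. by rewrite dot_sym; exact: mem_orthov1. Qed.

(** If the head lay in the span of the tail, it would be orthogonal to itself, against its norm
    being 1. *)
Lemma dot_orthonormal_free (s : seq vT) : orthonormal form s -> free s.
Proof.
elim: s => [|u s IHs] /=; first by rewrite nil_free.
rewrite /orthonormal /= => /andP[/andP[/eqP u1 s1] /andP[os ps]].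
rewrite free_cons IHs ?andbT; last by rewrite /orthonormal s1.
apply/negP => us.
have sub : (<<s>> <= orthov form <[u]>)%VS.
  apply/span_subvP => v vs; rewrite mem_orthov1_dot.
  by have /andP[/allP/(_ v vs)] := os.
have := subvP sub u us.
by rewrite mem_orthov1_dot u1 oner_eq0.
Qed.

Lemma dot_normalize (u : vT) : u != 0 ->
  exists2 c : R, c != 0 & form (c *: u) (c *: u) = 1.
Proof.
move=> u0; have fu := neq0_dnorm_gt0 (s := form) u u0.
have su : Num.sqrt (form u u) != 0 by rewrite sqrtr_eq0 -ltNge.
exists (Num.sqrt (form u u))^-1; first by rewrite invr_eq0.
(* The third occurrence of [form u u] is the one outside the square roots; writing it as a square
   leaves an identity in the root alone. *)
rewrite linearZl_LR linearZr_LR /= -{3}(sqr_sqrtr (ltW fu)).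
by field.
Qed.

(** Passing to the orthogonal complement of a vector lowers the dimension by at most one, so in
    dimension 3 some nonzero [t0] is orthogonal to both [u] and [v]. The basis only rescales [u] and
    [v], so homogeneous properties of these survive. *)
Lemma orthonormal_basis3 (u v : vT) : \dim {:vT} = 3%N ->
  u != 0 -> v != 0 -> form u v = 0 ->
  exists (a b : R) (t : vT), [/\ a != 0, b != 0,
    basis_of fullv [:: a *: u; b *: v; t] & orthonormal form [:: a *: u; b *: v; t]].
Proof.
move=> dim3 u0 v0 uv.
have [a a0 au] := dot_normalize u0.
have [b b0 bv] := dot_normalize v0.
have [t0 /and3P[t00 t0u t0v]] :
    exists t, [&& t != 0, t \in orthov form <[u]> & t \in orthov form <[v]>].
  exists (vpick (orthov form <[u]> :&: orthov form <[v]>)%VS).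
  rewrite -memv_cap memv_pick vpick0 andbT -dimv_eq0 -lt0n.
  have := leq_dim_orthov1 form u fullv; rewrite dim3 capfv => du.
  apply: leq_trans (leq_dim_orthov1 form v _).
  by case: (\dim (orthov form <[u]>)) du => [|[]].
have [c c0 ct] := dot_normalize t00.
have on : orthonormal form [:: a *: u; b *: v; c *: t0].
  move: t0u t0v; rewrite !mem_orthov1_dot => /eqP t0u /eqP t0v.
  rewrite /orthonormal /= au bv ct !eqxx /=.
  rewrite !linearZl_LR !linearZr_LR /= uv t0u t0v.
  by rewrite !mulr0 !eqxx.
exists a, b, (c *: t0); split=> //.
by rewrite basisEfree dot_orthonormal_free //= subvf /= dim3.
Qed.

End DotForms.

(** * The inner product of quadrilaterals and degeneracy, in coordinates *)

Section Inner.
Variable R : realType.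
Implicit Types (P Q : quad R) (u v w : 'rV[R]_2).

Lemma dotpE u v : dotp u v = u 0 0 * v 0 0 + u 0 1 * v 0 1.
Proof.
rewrite /dotp mxE big_ord_recl big_ord1 !mxE.
by rewrite (_ : lift ord0 ord0 = 1); last exact/val_inj.
Qed.

Lemma dotpC u v : dotp u v = dotp v u.
Proof. by rewrite !dotpE; ring. Qed.

Lemma innerE P Q : inner P Q =
  (P 0 0 - P 2 0) * (Q 0 0 - Q 2 0) + (P 0 1 - P 2 1) * (Q 0 1 - Q 2 1) +
  ((P 1 0 - P 3 0) * (Q 1 0 - Q 3 0) + (P 1 1 - P 3 1) * (Q 1 1 - Q 3 1)).
Proof. by rewrite /inner !dotpE !mxE. Qed.

Lemma inner_sym P Q : inner P Q = inner Q P.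
Proof. by rewrite !innerE; ring. Qed.

Lemma inner_linearl (a : R) P P' Q :
  inner (a *: P + P') Q = a * inner P Q + inner P' Q.
Proof. by rewrite !innerE !mxE; ring. Qed.

Lemma col2P m (M N : 'M[R]_(m, 2)) :
  (forall i, M i 0 = N i 0) -> (forall i, M i 1 = N i 1) -> M = N.
Proof.
move=> e0 e1; apply/matrixP => i [[|[|j]] hj] //.
  by rewrite (_ : Ordinal hj = 0) //; apply/val_inj.
by rewrite (_ : Ordinal hj = 1) //; apply/val_inj.
Qed.

Lemma row2P u v : u 0 0 = v 0 0 -> u 0 1 = v 0 1 -> u = v.
Proof. by move=> e0 e1; apply: col2P => i; rewrite ord1. Qed.

Lemma inner_gt0 P : diagAC P != 0 \/ diagBD P != 0 -> 0 < inner P P.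
Proof.
have dp0 u : 0 <= dotp u u by rewrite dotpE -!expr2 addr_ge0 ?sqr_ge0.
have dp u : u != 0 -> 0 < dotp u u.
  move=> u0; rewrite lt_neqAle dp0 andbT eq_sym; apply: contra u0.
  rewrite dotpE -!expr2 paddr_eq0 ?sqr_ge0 // !sqrf_eq0 => /andP[/eqP u0 /eqP u1].
  by apply/eqP/row2P; rewrite mxE.
by case=> /dp d; rewrite /inner; [apply: ltr_wpDr | apply: ltr_wpDl].
Qed.

Lemma row4P (Q : 'I_4 -> Prop) : Q 0 -> Q 1 -> Q 2 -> Q 3 -> forall i, Q i.
Proof.
move=> Q0 Q1 Q2 Q3 [[|[|[|[|i]]]] hi] //.
- by rewrite (_ : Ordinal hi = 0) //; apply/val_inj.
- by rewrite (_ : Ordinal hi = 1) //; apply/val_inj.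
- by rewrite (_ : Ordinal hi = 2) //; apply/val_inj.
- by rewrite (_ : Ordinal hi = 3) //; apply/val_inj.
Qed.

Lemma diag0_degenerate P : is_parallelogram P ->
  diagAC P = 0 \/ diagBD P = 0 -> degenerate P.
Proof.
move=> /rowP par [] /rowP d.
(* The coinciding vertices A and C are the midpoint of B and D, so the vertices sit at parameters 0,
   1, 0, -1 on the line through A and B. *)
- exists (vtxA P), (vtxB P - vtxA P).
  apply: row4P; [exists 0|exists 1|exists 0|exists (-1)];
  by apply/rowP => j; move: (par j) (d j); rewrite !mxE; lra.
- exists (vtxB P), (vtxA P - vtxB P).
  apply: row4P; [exists 1|exists 0|exists (-1)|exists 0];
  by apply/rowP => j; move: (par j) (d j); rewrite !mxE; lra.
Qed.

Lemma diagACZ a P : diagAC (a *: P) = a *: diagAC P.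
Proof. by apply/rowP => j; rewrite !mxE mulrBr. Qed.

Lemma diagBDZ a P : diagBD (a *: P) = a *: diagBD P.
Proof. by apply/rowP => j; rewrite !mxE mulrBr. Qed.

Lemma dotp0l u : dotp 0 u = 0. Proof. by rewrite dotpE !mxE !mul0r addr0. Qed.
Lemma dotp0r u : dotp u 0 = 0. Proof. by rewrite dotpE !mxE !mulr0 addr0. Qed.

End Inner.

(** * The space of conformally inscribed parallelograms and its coordinates *)

Section Inscribed.
Variables (R : realType) (mA mB mC mD bA : R).
Let K := Config (Line mA bA) (Line mB 1) (Line mC 0) (Line mD 0).
Hypothesis mCD : mC != mD.
Implicit Types (P : quad R).

Let mCD0 : mC - mD != 0. Proof. by rewrite subr_eq0. Qed.

Lemma inscribedP w P : inscribed (rescale w K) P <->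
  [/\ P 0 0 + P 2 0 = P 1 0 + P 3 0, P 0 1 + P 2 1 = P 1 1 + P 3 1
    & [/\ P 0 1 = mA * P 0 0 + bA * w, P 1 1 = mB * P 1 0 + w,
          P 2 1 = mC * P 2 0 & P 3 1 = mD * P 3 0]].
Proof.
rewrite /inscribed /is_parallelogram /on_line /= !mxE !mul0r !addr0 mul1r.
split=> [[par [? ? ? ?]]|[e0 e1 [? ? ? ?]]].
  by split=> //; [move/rowP/(_ 0): par | move/rowP/(_ 1): par]; rewrite !mxE.
by split=> //; apply: row2P; rewrite !mxE.
Qed.

Lemma inscribedZ a w P :
  inscribed (rescale w K) P -> inscribed (rescale (a * w) K) (a *: P).
Proof.
move=> /inscribedP[e0 e1 [A B C D]]; apply/inscribedP; rewrite !mxE -!mulrDr e0 e1 A B C D.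
by split=> //; split; ring.
Qed.

Lemma at_infinityZ a P : at_infinity K P -> at_infinity K (a *: P).
Proof. by move=> /(inscribedZ a); rewrite mulr0. Qed.

(** The ordinates are read off the lines at scale [w], so being inscribed reduces to the two
    equations between the diagonal midpoints. *)
Definition quad_of_abscissas (xA xB xC xD w : R) : quad R :=
  \matrix_(i, j) nth 0 (nth [::] [:: [:: xA; mA * xA + bA * w];
    [:: xB; mB * xB + w]; [:: xC; mC * xC]; [:: xD; mD * xD]] i) j.

Lemma quad_of_abscissasP xA xB xC xD w :
  xA + xC = xB + xD ->
  mA * xA + bA * w + mC * xC = mB * xB + w + mD * xD ->
  inscribed (rescale w K) (quad_of_abscissas xA xB xC xD w).
Proof. by move=> e0 e1; apply/inscribedP; rewrite !mxE. Qed.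

(* The abscissas of C and D solve a linear system of determinant mC - mD. *)
Definition inscribed_of (v : 'rV[R]_3) : quad R :=
  let xA := v 0 0 in let xB := v 0 1 in let w := v 0 2 in
  let xC := (mB * xB + w - mA * xA - bA * w - mD * (xB - xA)) / (mC - mD) in
  quad_of_abscissas xA xB xC (xC - (xB - xA)) w.

(** The line B has intercept 1, so the third entry recovers the scale from the vertex on B(w). *)
Definition params_of (P : quad R) : 'rV[R]_3 :=
  \row_j nth 0 [:: P 0 0; P 1 0; P 1 1 - mB * P 1 0] j.

Lemma inscribed_of_linear : linear inscribed_of.
Proof.
by move=> a u v; apply: col2P; apply: row4P; rewrite !mxE /=; field.
Qed.

HB.instance Definition _ :=
  GRing.isLinear.Build R 'rV[R]_3 (quad R) _ inscribed_of inscribed_of_linear.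

Lemma inscribed_ofK : cancel inscribed_of params_of.
Proof.
move=> v; apply/rowP => j; rewrite !mxE.
case: j => [[|[|[|j]]] hj] //=.
- by congr (v _ _); apply/val_inj.
- by congr (v _ _); apply/val_inj.
- rewrite addrC addKr; by congr (v _ _); apply/val_inj.
Qed.

(** Eliminating the abscissa of D from the midpoint equations leaves one linear equation for that of
    C, with nonzero coefficient [mC - mD]. *)
Lemma params_ofK w P : inscribed (rescale w K) P -> inscribed_of (params_of P) = P.
Proof.
move=> /inscribedP[e0 e1 [A B C D]].
have xD : P 3 0 = P 0 0 + P 2 0 - P 1 0 by rewrite e0; ring.
have xC : (mB * P 1 0 + w - mA * P 0 0 - bA * w - mD * (P 1 0 - P 0 0)) / (mC - mD) = P 2 0.
  have : mB * P 1 0 + w - mA * P 0 0 - bA * w - mD * (P 1 0 - P 0 0) = P 2 0 * (mC - mD).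
    by move: e1; rewrite A B C D xD => e1; lra.
  by move=> ->; rewrite mulfK.
have wE : P 1 1 - mB * P 1 0 = w by rewrite B; ring.
rewrite /inscribed_of !mxE /= wE xC.
have -> : P 2 0 - (P 1 0 - P 0 0) = P 3 0 by rewrite xD; ring.
by apply: col2P; apply: row4P; rewrite mxE /= ?A ?B ?C ?D.
Qed.

(** As an image, it is a subspace by construction; the left inverse [params_of] then gives the
    dimension. *)
Definition Pi : {vspace quad R} := limg (linfun inscribed_of).

Lemma memPi P : P \in Pi <-> conformally_inscribed K P.
Proof.
split=> [/memv_imgP[v _ ->]|[w /params_ofK <-]]; last first.
  by rewrite -(lfunE inscribed_of) memv_img ?memvf.
exists (v 0 2); rewrite lfunE; apply: quad_of_abscissasP; first by ring.
by field.
Qed.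

Lemma dim_Pi : \dim Pi = 3%N.
Proof.
rewrite limg_dim_eq ?dimvf ?dim_matrix //=; apply/eqP.
rewrite capfv -subv0; apply/subvP => v; rewrite memv_ker lfunE /= memv0 => /eqP v0.
by rewrite -(inscribed_ofK v) v0 -(linear0 inscribed_of) inscribed_ofK.
Qed.

(* The common vertex lies on C and D, hence is the origin; as it also lies on
   B(w), the scale w vanishes. *)
Lemma diag_eq0 P : conformally_inscribed K P -> diagAC P = 0 -> diagBD P = 0 -> P = 0.
Proof.
move=> [w /inscribedP[e0 e1 [A B C D]]] /rowP AC /rowP BD.
move: (AC 0) (AC 1) (BD 0) (BD 1); rewrite !mxE.
move=> /subr0_eq AC0 /subr0_eq AC1 /subr0_eq BD0 /subr0_eq BD1.
have x20 : P 2 0 = P 3 0 by move: e0; rewrite AC0 BD0; lra.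
have x21 : P 2 1 = P 3 1 by move: e1; rewrite AC1 BD1; lra.
have x0 : P 3 0 = 0.
  apply: (mulfI mCD0); rewrite mulr0 mulrBl -D -{1}x20 -C x21; ring.
by apply: col2P; apply: row4P; rewrite mxE ?AC0 ?AC1 ?BD0 ?BD1 ?x20 ?x21 ?D x0 ?mulr0.
Qed.

(** * Parallelograms with one vanishing diagonal, and their scales *)

(** Such a [U] has its vertices A and C at a common point of A(w) and C, which is the midpoint of B
    and D. If this point has abscissa x, the ordinates require 2(mC - mD)x = (mB - mD)xB + w, where
    xB is the abscissa of B. *)
Lemma exists_diagAC0 : exists U : quad R,
  [/\ conformally_inscribed K U, U != 0, diagAC U = 0
    & mA = mC \/ mB = mD -> at_infinity K U].
Proof.
have nz (x0 x1 x2 x3 w : R) : x1 != 0 \/ w != 0 -> quad_of_abscissas x0 x1 x2 x3 w != 0.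
  move=> h; apply/eqP => /matrixP e; move: (e 1 0) (e 1 1); rewrite !mxE /= => x10 w0.
  by case: h => /eqP; apply; [|move: w0; rewrite x10 mulr0 add0r].
have d0 (x0 x1 x2 x3 w : R) : x0 = x2 -> mA * x0 + bA * w = mC * x2 ->
    diagAC (quad_of_abscissas x0 x1 x2 x3 w) = 0.
  by move=> e0 e1; apply: row2P; rewrite !mxE /= ?e0 ?e1 ?subrr // -e1 e0 subrr.
case: (eqVneq mA mC) => [AC|AC].
  (* At scale 0 the lines A and C coincide, so x is free; the choice of x and xB balances the
     equation 2(mC - mD)x = (mB - mD)xB. *)
  have i : inscribed (rescale 0 K)
      (quad_of_abscissas (mB - mD) (2 * (mC - mD)) (mB - mD) (2 * (mB - mC)) 0).
    by apply: quad_of_abscissasP; rewrite ?AC; ring.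
  exists (quad_of_abscissas (mB - mD) (2 * (mC - mD)) (mB - mD) (2 * (mB - mC)) 0).
  split=> //; first by exists 0.
    by apply: nz; left; rewrite mulf_neq0 ?pnatr_eq0.
  by apply: d0; rewrite ?AC; ring.
case: (eqVneq mB mD) => [BD|BD].
  (* At scale 0 the lines B and D coincide: A and C go to the origin, B and D to opposite points of
     D. *)
  have i : inscribed (rescale 0 K) (quad_of_abscissas 0 1 0 (-1) 0).
    by apply: quad_of_abscissasP; rewrite ?BD; ring.
  exists (quad_of_abscissas 0 1 0 (-1) 0); split=> //; first by exists 0.
    by apply: nz; left; rewrite oner_eq0.
  by apply: d0; ring.
(* A(w) and C meet where (mC - mA)x = bA w; the common factor [mB - mD] makes the equation for the
   abscissa [y] of B solvable without division. *)
set w := (mC - mA) * (mB - mD); set x := bA * (mB - mD).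
set y := 2 * (mC - mD) * bA - (mC - mA).
exists (quad_of_abscissas x y x (2 * x - y) w); split.
- by exists w; apply: quad_of_abscissasP; rewrite /x /y /w; ring.
- by apply: nz; right; rewrite mulf_neq0 // subr_eq0 // eq_sym.
- by apply: d0 => //; rewrite /x /w; ring.
- by case=> e; [move: AC|move: BD]; rewrite e eqxx.
Qed.

(** The same construction with B and D at a common point of B(w) and D, of abscissa q. The ordinates
    now require (mA - mC)xA + bA w = 2(mD - mC)q, and in the generic case the intersection gives (mD
    - mB)q = w. *)
Lemma exists_diagBD0 : exists V : quad R,
  [/\ conformally_inscribed K V, V != 0, diagBD V = 0
    & mA = mC \/ mB = mD -> at_infinity K V].
Proof.
have nz (x0 x1 x2 x3 w : R) : x0 != 0 \/ x1 != 0 -> quad_of_abscissas x0 x1 x2 x3 w != 0.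
  move=> h; apply/eqP => /matrixP e; move: (e 0 0) (e 1 0); rewrite !mxE /= => x00 x10.
  by case: h => /eqP.
have d0 (x0 x1 x2 x3 w : R) : x1 = x3 -> mB * x1 + w = mD * x3 ->
    diagBD (quad_of_abscissas x0 x1 x2 x3 w) = 0.
  by move=> e0 e1; apply: row2P; rewrite !mxE /= ?e0 ?e1 ?subrr // -e1 e0 subrr.
case: (eqVneq mB mD) => [BD|BD].
  have i : inscribed (rescale 0 K)
      (quad_of_abscissas (2 * (mD - mC)) (mA - mC) (2 * (mA - mD)) (mA - mC) 0).
    by apply: quad_of_abscissasP; rewrite ?BD; ring.
  exists (quad_of_abscissas (2 * (mD - mC)) (mA - mC) (2 * (mA - mD)) (mA - mC) 0).
  split=> //; first by exists 0.
    by apply: nz; left; rewrite mulf_neq0 ?pnatr_eq0 // subr_eq0 eq_sym.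
  by apply: d0; rewrite ?BD; ring.
case: (eqVneq mA mC) => [AC|AC].
  have i : inscribed (rescale 0 K) (quad_of_abscissas 1 0 (-1) 0 0).
    by apply: quad_of_abscissasP; rewrite ?AC; ring.
  exists (quad_of_abscissas 1 0 (-1) 0 0); split=> //; first by exists 0.
    by apply: nz; left; rewrite oner_eq0.
  by apply: d0; ring.
set w := (mD - mB) * (mA - mC); set q := mA - mC.
set x := 2 * (mD - mC) - bA * (mD - mB).
exists (quad_of_abscissas x q (2 * q - x) q w); split.
- by exists w; apply: quad_of_abscissasP; rewrite /x /q /w; ring.
- by apply: nz; right; rewrite subr_eq0.
- by apply: d0 => //; rewrite /q /w; ring.
- by case=> e; [move: AC|move: BD]; rewrite e eqxx.
Qed.

(** At scale 0 all four lines pass through the origin. Without parallel pairs, A and C coincide at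
    the origin, so B and D are opposite points; then B lies on both of the lines B(0) and D, which
    puts all vertices at the origin. *)
Lemma diagAC0_at_infinity P : at_infinity K P -> diagAC P = 0 -> P != 0 ->
  mA = mC \/ mB = mD.
Proof.
move=> inf /rowP AC nz.
have /inscribedP[e0 e1 [A B C D]] := inf.
move: (AC 0) (AC 1); rewrite !mxE => /subr0_eq AC0 /subr0_eq AC1.
case: (eqVneq mA mC) => [|mAC]; first by left.
case: (eqVneq mB mD) => [|mBD]; first by right.
have x0 : P 2 0 = 0.
  have : mA - mC != 0 by rewrite subr_eq0.
  move/mulfI; apply; rewrite mulr0 mulrBl -C -AC1 A AC0; ring.
have x3 : P 3 0 = - P 1 0 by move: e0; rewrite AC0 x0; lra.
have x1 : P 1 0 = 0.
  have : mB - mD != 0 by rewrite subr_eq0.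
  by move/mulfI; apply; move: e1; rewrite A B C D AC0 x0 x3; lra.
move/eqP: nz; case.
rewrite -(params_ofK inf) (_ : params_of P = 0) ?linear0 //.
apply/rowP => j; rewrite !mxE B x1 AC0 x0 mulr0 addr0 subrr.
by case: j => [[|[|[|j]]] hj].
Qed.

(** * The Euclidean structure on [Pi] *)

(** The restriction to [Pi] matters: on all quadrilaterals the form is only semidefinite, since it
    vanishes when the four vertices are equal. *)
Definition inner_Pi (P Q : subvs_of Pi) : R := inner (vsval P) (vsval Q).

Lemma inner_Pi_gt0 (P : subvs_of Pi) : P != 0 -> 0 < inner_Pi P P.
Proof.
move=> P0; apply: inner_gt0.
case: (eqVneq (diagAC (vsval P)) 0) => AC; last by left.
case: (eqVneq (diagBD (vsval P)) 0) => BD; last by right.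
move: P0; rewrite -subr_eq0 subr0 -(inj_eq val_inj) /= => /eqP[].
by apply: diag_eq0 => //; apply/memPi; exact: subvsP.
Qed.

Lemma inner_Pi_bilinear : bilinear_for *%R ( idfun \; *%R) inner_Pi.
Proof.
split=> [P|P] a Q Q' /=; rewrite /inner_Pi linearP; last rewrite !(inner_sym (vsval P)).
  by rewrite inner_linearl.
by rewrite inner_linearl.
Qed.

HB.instance Definition _ := bilinear_isBilinear.Build R (subvs_of Pi) (subvs_of Pi) R
  *%R (idfun \; *%R) inner_Pi inner_Pi_bilinear.

(** Over the reals, symmetry is the Hermitian law with sign +1 and trivial conjugation. *)
Lemma inner_Pi_herm (P Q : subvs_of Pi) : inner_Pi P Q = (-1) ^+ false * idfun (inner_Pi Q P).
Proof. by rewrite expr0 mul1r; exact: inner_sym. Qed.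

HB.instance Definition _ := isHermitianSesquilinear.Build R (subvs_of Pi) false idfun inner_Pi inner_Pi_herm.
HB.instance Definition _ := isDotProduct.Build R (subvs_of Pi) inner_Pi inner_Pi_gt0.

Definition dot_Pi : {dot (subvs_of Pi) for idfun} := inner_Pi.

End Inscribed.

Theorem theorem2p6 (R : realType) (mA mB mC mD bA : R) :
  let K := Config (Line mA bA) (Line mB 1) (Line mC 0) (Line mD 0) in
  ~ concurrent K ->
  mC != mD ->
  exists (Pi : {vspace quad R}) (ip : {dot (subvs_of Pi) for idfun}),
    [/\ forall P : quad R, P \in Pi <-> conformally_inscribed K P,
        forall P Q : subvs_of Pi, ip P Q = inner (vsval P) (vsval Q)
      & exists U V T : subvs_of Pi,
        [/\ basis_of fullv [:: U; V; T] /\ orthonormal ip [:: U; V; T],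
            degenerate (vsval U) /\ degenerate (vsval V),
            diagAC (vsval U) = 0 /\ diagBD (vsval V) = 0,
            dotp (diagAC (vsval T)) (diagAC (vsval V)) = 0 /\
            dotp (diagBD (vsval T)) (diagBD (vsval U)) = 0
          & at_infinity K (vsval U) /\ at_infinity K (vsval V) <->
            parallel (lineA K) (lineC K) \/ parallel (lineB K) (lineD K)]].
Proof.
move=> K _ mCD; exists (Pi mA mB mC mD bA), (dot_Pi mA mB bA mCD).
split=> [P||]; [exact: memPi | by [] |].
have [U0 [/(memPi mA mB bA mCD) PU U0nz U0AC Uinf]] := exists_diagAC0 mA mB bA mCD.
have [V0 [/(memPi mA mB bA mCD) PV V0nz V0BD Vinf]] := exists_diagBD0 mA mB bA mCD.
pose u := Subvs PU; pose v := Subvs PV.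
have nz (x : subvs_of (Pi mA mB mC mD bA)) : vsval x != 0 -> x != 0.
  by apply: contra_neq => ->; rewrite linear0.
have uv : dot_Pi mA mB bA mCD u v = 0.
  by rewrite /dot_Pi /= /inner_Pi /inner /= U0AC V0BD dotp0l dotp0r addr0.
have dim3 : \dim {: subvs_of (Pi mA mB mC mD bA)} = 3%N.
  by rewrite dimvf /dim /= dim_Pi.
have [a [b [t [a0 b0 bas on]]]] := orthonormal_basis3 dim3 (nz u U0nz) (nz v V0nz) uv.
have UAC : diagAC (vsval (a *: u)) = 0 by rewrite linearZ diagACZ /= U0AC scaler0.
have VBD : diagBD (vsval (b *: v)) = 0 by rewrite linearZ diagBDZ /= V0BD scaler0.
have par (x : subvs_of (Pi mA mB mC mD bA)) : is_parallelogram (vsval x).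
  by have /(memPi mA mB bA mCD)[w []] := subvsP x.
exists (a *: u), (b *: v), t; split=> //.
- by split; apply: diag0_degenerate => //; [left|right].
(* Since [U] has no AC part and [V] no BD part, orthogonality of [t] to each of them is a condition
   on a single diagonal. *)
- move: on; rewrite /orthonormal /= !andbT => /andP[_ /andP[/andP[_ /eqP ut] /eqP vt]].
  move: ut vt; rewrite /dot_Pi /= /inner_Pi /inner UAC VBD !dotp0l add0r addr0.
  by move=> ut vt; rewrite dotpC vt dotpC ut.
split=> [[inf _]|h].
  apply: (diagAC0_at_infinity mCD inf UAC).
  by rewrite linearZ scaler_eq0 negb_or a0.
(* Normalization multiplies the scale by a constant, so scale 0 is preserved. *)
by split; rewrite linearZ; apply: at_infinityZ; [apply: Uinf|apply: Vinf].
Qed.
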